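(* Let $X$ be a separable Banach space, $Y$ a Banach space, and $G \subset X$ an open set. Suppose that $f:G \to Y$ has the Baire property and is Gâteaux differentiable at every point of $G$. Then $f$ is Hadamard differentiable at all points of $G$ except a nowhere dense $\sigma$-directionally porous set.
   Context: Banach spaces are real. $B(x,r)$ is the open ball with center $x$ and radius $r$. Let $X,Y$ be Banach spaces, $G\subset X$ open, $f:G\to Y$, $x\in G$. In a metric space, the system of sets with the Baire property is the smallest $\sigma$-algebra containing all open sets and all first category (meager) sets. A mapping $f$ between metric spaces has the Baire property if $f^{-1}(B)$ has the Baire property for every Borel subset $B$ of the target. $f$ is Gâteaux differentiable at $x$ if there is a continuous linear operator $L:X\to Y$ with $\lim_{t\to 0}\frac{f(x+tv)-f(x)}{t}=L(v)$ for each $v\in X$. $f$ is Hadamard differentiable at $x$ if there is a continuous linear operator $L:X\to Y$ such that $\lim_{t\to 0}\frac{f(x+tv)-f(x)}{t}=L(v)$ for each $v\in X$ and, for every compact set $C\subset X$, the limit is uniform with respect to $v\in C$. A set $A\subset X$ is directionally porous at $x\in X$ if there exist $0\ne v\in X$, $p>0$ and a sequence $t_n\to 0$ of positive real numbers such that $B(x+t_nv,pt_n)\cap A=\emptyset$ for each $n$. $A$ is directionally porous if it is directionally porous at each $x\in A$. $A$ is $\sigma$-directionally porous if it is a countable union of directionally porous sets. *)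

(* Defs.v *)
From HB Require Import structures.
From mathcomp Require Import all_boot all_order all_algebra.
From mathcomp Require Import all_classical all_reals all_analysis.

Set Implicit Arguments.
Unset Strict Implicit.
Unset Printing Implicit Defensive.

Import Order.TTheory GRing.Theory Num.Theory.
Import numFieldNormedType.Exports.

Local Open Scope classical_set_scope.
Local Open Scope ring_scope.

Definition separable_space (T : topologicalType) : Prop :=
  exists2 D : set T, countable D & dense D.

Definition nowhere_dense (T : topologicalType) (A : set T) : Prop :=
  interior (closure A) = set0.

(* Repetitions and empty terms are allowed in F, so finite unions are included. *)
Definition first_category (T : topologicalType) (A : set T) : Prop :=
  exists2 F : (set T)^nat,
    (forall n, nowhere_dense (F n)) & A = \bigcup_n F n.

Definition baire_property (T : topologicalType) : set (set T) :=
  <<s (@open T) `|` (@first_category T) >>.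

Definition has_baire_property (S T : topologicalType) (f : S -> T) : Prop :=
  forall B : set T, <<s (@open T) >> B -> baire_property (f @^-1` B).

(* A map defined on an open set G is represented by a total function f; at a
   point of G the notions below only depend on the restriction of f to G. *)
Section differentiability.
Context {R : realType} {X Y : normedModType R}.
Implicit Types (f : X -> Y) (x : X) (L : {linear X -> Y}).

Definition gateaux_differentiable f x : Prop :=
  exists L, continuous L /\ forall v, is_derive x v f (L v).

Definition hadamard_differentiable f x : Prop :=
  exists L,
    [/\ continuous L,
        forall v, is_derive x v f (L v) &
        forall C : set X, compact C ->
          {uniform C, (fun (t : R) (v : X) =>
                         t^-1 *: (f (x + t *: v) - f x)) @ 0^' --> (L : X -> Y)}].

End differentiability.

Section porosity.
Context {R : realType} {X : normedModType R}.
Implicit Types (A : set X) (x : X).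

Definition directionally_porous_at A x : Prop :=
  exists (v : X) (p : R) (t : R^nat),
    [/\ v != 0, 0 < p, (forall n, 0 < t n), t @ \oo --> 0 &
        forall n, ball (x + t n *: v) (p * t n) `&` A = set0].

Definition directionally_porous A : Prop :=
  forall x, A x -> directionally_porous_at A x.

Definition sigma_directionally_porous A : Prop :=
  exists2 F : (set X)^nat,
    (forall n, directionally_porous (F n)) & A = \bigcup_n F n.

End porosity.

(* Main.v *)
Require Import Defs.
From HB Require Import structures.
From mathcomp Require Import all_boot all_order all_algebra.
From mathcomp Require Import all_classical all_reals all_analysis.
From mathcomp Require Import ring lra.
Import Order.TTheory GRing.Theory Num.Theory.
Import numFieldNormedType.Exports.
Local Open Scope classical_set_scope.
Local Open Scope ring_scope.

(** Call a set [A] thick at [x] if for each direction [v] and each [p > 0] the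
    balls of radius [p t] about [x + t v] meet [A] for all small [t > 0]. For a point
    [x] of [A], failing to be thick at [x] is directional porosity of [A] at
    [x]; and a set that is dense in an open set is thick at each of its points.

    So it suffices to cover [G] by countably many sets such that thickness at
    [x] forces Hadamard differentiability at [x]. Inside each set of the cover
    the exceptional points then form a directionally porous set. Moreover, by
    Baire's theorem, every open part of [G] contains a smaller open set in which
    one member of the cover is dense, and hence no exceptional point; this is
    nowhere density. The argument goes through two families of sets: thickness
    of a member of the first, which covers [G], puts [x] into the union of the
    second; thickness of a member of the second gives Hadamard differentiability.

    First family. For [x] in [G] and a direction
    [v], Gateaux differentiability gives [n] with
    [|f (x + h v) - f x| <= n h] for all steps [h = 1/(k+1)], [k >= n]. For a
    given [n] these [v] form a set with the Baire property, so for some [n] the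
    set is residual in some ball, which can be taken from a countable family.
    This indexes the family ([cone_points], [cone_points_cover]). The bound
    holds a priori only at generic points of the cone [x + h B(a, r)], but it
    passes to every point [y] of the cone ([generic_value_bound]): [f] is
    continuous at [y] along every ray, and almost every ray from [y] avoids the
    exceptional meager set at all the points used. If such a set is thick at
    [x], then [x] and any nearby [y] lie in a common cone, of height comparable
    to [|x - y|], whose vertex [x'] is in the set; comparing both values with
    [f x'] gives [|f x - f y| <= m |x - y|] ([thick_cone_lipschitz]).

    Second family: the sets of points where [f] satisfies such an estimate with
    constant [m] at scale [1/(m+1)]. If one of them is thick at [x], then
    [f (x + t w)] and [f (x + t v)] can be compared through a point of the set
    close to [x + t v]; so the difference quotients at [x] are nearly constant
    on a neighbourhood of each direction, and a compactness argument turns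
    Gateaux into Hadamard differentiability ([thick_lipschitz_hadamard]). *)

Set Implicit Arguments.
Unset Strict Implicit.
Unset Printing Implicit Defensive.

(** * Meager sets and sets that are open modulo a meager set *)

Section category.
Context {T : topologicalType}.
Implicit Types A B U V : set T.

Lemma nowhere_denseP A :
  nowhere_dense A <->
  forall U, open U -> U !=set0 ->
    exists V, [/\ open V, V !=set0, V `<=` U & V `&` A = set0].
Proof.
split=> [ndA U oU U0|h].
  exists (U `\` closure A); split.
  - by rewrite setDE; apply: openI => //; exact/closed_openC/closed_closure.
  - apply/set0P/negP => /eqP; rewrite setD_eq0 => UA.
    have [x Ux] := U0.
    have : interior (closure A) x.
      by apply: (filterS UA); exact: open_nbhs_nbhs.
    by rewrite ndA.
  - exact: subDsetl.
  - rewrite -subset0 => x [[_ nA] Ax]; apply: nA; exact: subset_closure.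
rewrite /nowhere_dense -subset0 => x Ax.
have [V [oV [y Vy] VA VA0]] := h _ (open_interior _) (ex_intro _ x Ax).
have /(_ V)[|z [Az Vz]] := interior_subset (VA y Vy).
  exact: open_nbhs_nbhs.
by have : (V `&` A) z by []; rewrite VA0.
Qed.

Lemma nowhere_dense_sub A B : A `<=` B -> nowhere_dense B -> nowhere_dense A.
Proof.
move=> AB /nowhere_denseP h; apply/nowhere_denseP => U oU U0.
have [V [oV V0 VU VB]] := h U oU U0; exists V; split => //.
by rewrite -subset0 -VB; exact: setIS.
Qed.

Lemma nowhere_dense0 : nowhere_dense (set0 : set T).
Proof. by rewrite /nowhere_dense closure0 interior0. Qed.

Lemma first_category_cover A (F : (set T)^nat) :
  (forall n, nowhere_dense (F n)) -> A `<=` \bigcup_n F n -> first_category A.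
Proof.
move=> ndF AF; exists (fun n => A `&` F n).
  by move=> n; apply: nowhere_dense_sub (ndF n); exact: subIsetr.
by rewrite -setI_bigcupr; apply/esym/setIidPl.
Qed.

Lemma first_category_sub A B : A `<=` B -> first_category B -> first_category A.
Proof. by move=> AB [F ndF BE]; apply: first_category_cover ndF _; rewrite -BE. Qed.

Lemma nowhere_dense_first_category A : nowhere_dense A -> first_category A.
Proof.
move=> ndA; apply: (@first_category_cover _ (fun=> A)) => // x Ax.
by exists 0%N.
Qed.

Lemma first_category_bigcup (I : countType) (A : I -> set T) :
  (forall i, first_category (A i)) -> first_category (\bigcup_i A i).
Proof.
move=> mA; have /all_sig2[F ndF AF] i := cid2 (mA i).
apply: (@first_category_cover _
    (fun k => if unpickle k is Some (i, n) then F i n else set0)).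
  move=> k; case: unpickle => [[i n]|]; last exact: nowhere_dense0.
  exact: ndF.
move=> x [i _]; rewrite AF => -[n _ Fx]; exists (pickle (i, n)) => //.
by rewrite pickleK.
Qed.

Lemma nowhere_dense_boundary U : open U -> nowhere_dense (closure U `\` U).
Proof.
move=> oU; apply/nowhere_denseP => W oW W0.
have [WU|/set0P WU] := eqVneq (W `&` U) set0.
  exists W; split => //; rewrite -subset0 => x [Wx [clU _]].
  have [y [Uy Wy]] := clU W (open_nbhs_nbhs (conj oW Wx)).
  by have : (W `&` U) y by []; rewrite WU.
exists (W `&` U); split; [exact: openI|by []|exact: subIsetl|].
by rewrite -subset0 => x [[_ Ux] [_ nUx]].
Qed.

(** The usual normal form of sets with the Baire property: open up to a meager
    set. Unlike membership in a generated sigma-algebra, it yields a ball in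
    which a non-meager set is residual. *)
Definition almost_open A :=
  exists2 U, open U & first_category ((A `\` U) `|` (U `\` A)).

Lemma open_almost_open U : open U -> almost_open U.
Proof.
move=> oU; exists U => //; rewrite setDv setU0.
by apply: nowhere_dense_first_category; exact: nowhere_dense0.
Qed.

Lemma first_category_almost_open A : first_category A -> almost_open A.
Proof.
by move=> mA; exists set0; [exact: open0|rewrite setD0 set0D setU0].
Qed.

(** If [A] is [U] modulo a meager set, its complement is the exterior of [U]
    modulo a meager set, since the boundary of an open set is nowhere dense. *)
Lemma almost_openC A : almost_open A -> almost_open (~` A).
Proof.
move=> [U oU mU]; exists (~` closure U).
  by apply/closed_openC; exact: closed_closure.
apply: (@first_category_sub _ (\bigcup_(b : bool) if b then closure U `\` U
    else (A `\` U) `|` (U `\` A))); last first.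
  apply: first_category_bigcup => -[] //.
  by apply/nowhere_dense_first_category/nowhere_dense_boundary.
move=> x [[nAx /contrapT clx]|[nclx /contrapT Ax]].
  have [Ux|nUx] := pselect (U x); last by exists true.
  by exists false => //; right.
exists false => //; left; split => // Ux; apply: nclx.
exact: subset_closure.
Qed.

Lemma almost_open_bigcup (A : (set T)^nat) :
  (forall n, almost_open (A n)) -> almost_open (\bigcup_n A n).
Proof.
move=> aoA; have /all_sig2[U oU mU] n := cid2 (aoA n); exists (\bigcup_n U n).
  exact: bigcup_open.
apply: first_category_sub (first_category_bigcup mU) => x.
move=> [[[n _ Anx] nU]|[[n _ Unx] nA]]; exists n => //; [left|right]; split => //.
- by move=> Unx; apply: nU; exists n.
- by move=> Anx; apply: nA; exists n.
Qed.

Lemma almost_open_bigcap (A : (set T)^nat) :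
  (forall n, almost_open (A n)) -> almost_open (\bigcap_n A n).
Proof.
move=> aoA; rewrite -[X in almost_open X]setCK setC_bigcap.
by apply/almost_openC/almost_open_bigcup => n; exact: almost_openC.
Qed.

Lemma almost_openI A B : almost_open A -> almost_open B -> almost_open (A `&` B).
Proof.
by move=> aA aB; rewrite -bigcap2E; apply: almost_open_bigcap => -[|[|n]] //=;
  apply/open_almost_open/openT.
Qed.

End category.

Section homeomorphism.
Context {S T : topologicalType} {g : S -> T} {h : T -> S}.
Hypotheses (cg : continuous g) (ch : continuous h).
Hypotheses (gK : cancel g h) (hK : cancel h g).

Lemma first_category_preimage (A : set T) :
  first_category A -> first_category (g @^-1` A).
Proof.
move=> [F ndF ->]; rewrite preimage_bigcup.
exists (fun n => g @^-1` F n) => // n; apply/nowhere_denseP => U oU [x Ux].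
have [||V [oV [y Vy] VU VF]] := (nowhere_denseP (F n)).1 (ndF n) (h @^-1` U).
- by apply: open_comp => // z _; exact: ch.
- by exists (g x); rewrite /= gK.
exists (g @^-1` V); split.
- by apply: open_comp => // z _; exact: cg.
- by exists (h y); rewrite /= hK.
- by move=> z /VU /=; rewrite gK.
- by rewrite -preimage_setI VF preimage_set0.
Qed.

Lemma almost_open_preimage (A : set T) :
  almost_open A -> almost_open (g @^-1` A).
Proof.
move=> [U oU mU]; exists (g @^-1` U).
  by apply: open_comp => // z _; exact: cg.
exact: first_category_preimage mU.
Qed.

End homeomorphism.

Section open_subspace.
Context {T : topologicalType} {G : set T}.
Hypothesis openG : open G.

Lemma open_set_val_image (V : set G) : open V -> open (set_val @` V).
Proof.
move=> [W oW <-]; have -> : set_val @` (set_val @^-1` W : set G) = W `&` G.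
  rewrite predeqE => x; split=> [[y Wy <-]|[Wx Gx]].
    by split => //; exact: set_valP.
  by exists (SigSub (mem_set Gx)).
exact: openI.
Qed.

Lemma nowhere_dense_set_val_image (A : set G) :
  nowhere_dense A -> nowhere_dense (set_val @` A).
Proof.
move=> /nowhere_denseP ndA; apply/nowhere_denseP => U oU U0.
have [UG|/set0P UG] := eqVneq (U `&` G) set0.
  exists U; split => //; rewrite -subset0 => x [Ux [y Ay xE]].
  have : (U `&` G) x by split => //; rewrite -xE; exact: set_valP.
  by rewrite UG.
have [x [Ux Gx]] := UG.
have [||V [oV [y Vy] VU VA]] := ndA (set_val @^-1` U).
- by exists U.
- by exists (SigSub (mem_set Gx)).
exists (set_val @` V); split.
- exact: open_set_val_image.
- by exists (set_val y), y.
- by move=> _ [z /VU Uz <-].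
- rewrite -subset0 => w [[z Vz <-] [z' Az' /val_inj zz']].
  have : (V `&` A) z by split => //; rewrite -zz'.
  by rewrite VA.
Qed.

(** The sets whose image is almost open form a sigma-algebra on [G], because
    [G], relative to which complements are taken, is open. *)
Lemma baire_property_set_val_image (A : set G) :
  baire_property A -> almost_open (set_val @` A).
Proof.
move: A; apply: smallest_sub => [|A [oA|mA]].
- split=> [|A aA|A aA].
  + by rewrite image_set0; apply/open_almost_open/open0.
  + rewrite [X in almost_open X](_ : _ = G `&` ~` (set_val @` A)).
      by apply: almost_openI; [exact: open_almost_open|exact: almost_openC].
    rewrite predeqE => x; split=> [[y [_ nAy] <-]|[Gx nAx]].
      split; first exact: set_valP.
      by move=> [z Az /val_inj zy]; apply: nAy; rewrite -zy.
    exists (SigSub (mem_set Gx)) => //; split => // Ax; apply: nAx.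
    by exists (SigSub (mem_set Gx)).
  + by rewrite image_bigcup; exact: almost_open_bigcup.
- by apply/open_almost_open/open_set_val_image.
- apply: first_category_almost_open; have [F ndF ->] := mA.
  rewrite image_bigcup; exists (fun n => set_val @` F n) => // n.
  exact: nowhere_dense_set_val_image.
Qed.

End open_subspace.

(** * Baire's theorem and separability *)

Section banach_category.
Context {R : realType} {X : completeNormedModType R}.
Implicit Types U W : set X.

Lemma open_not_first_category U : open U -> U !=set0 -> ~ first_category U.
Proof.
move=> oU U0 [F ndF UF].
have [n|x [Ux nFx]] := @Baire R X (fun n => ~` closure (F n)) _ U U0 oU.
  split; first exact/closed_openC/closed_closure.
  move=> V V0 oV; have [W [oW [x Wx] WV WF]] := (nowhere_denseP (F n)).1 (ndF n) V oV V0.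
  exists x; split; first exact: WV.
  move=> clx; have [y [Fy Wy]] := clx W (open_nbhs_nbhs (conj oW Wx)).
  by have : (W `&` F n) y by []; rewrite WF.
move: Ux; rewrite UF => -[n _ Fnx].
by apply: (nFx n I); exact: subset_closure.
Qed.

(** Otherwise each [E i] would be nowhere dense in [W], and [W] meager. *)
Lemma open_cover_somewhere_dense (I : countType) (E : I -> set X) W :
  open W -> W !=set0 -> W `<=` \bigcup_i E i ->
  exists i V, [/\ open V, V !=set0, V `<=` W & V `<=` closure (E i)].
Proof.
move=> oW W0 WE; apply: contrapT => nE.
apply: (open_not_first_category oW W0).
apply: (@first_category_sub _ _ (\bigcup_i (E i `&` W))).
  by move=> x Wx; have [i _ Eix] := WE x Wx; exists i.
apply: first_category_bigcup => i; apply: nowhere_dense_first_category.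
apply/nowhere_denseP => U oU U0.
have [UW|/set0P UW] := eqVneq (U `&` W) set0.
  by exists U; split => //; rewrite setICA UW setI0.
exists ((U `&` W) `\` closure (E i)); split.
- rewrite setDE; apply: openI; first exact: openI.
  exact/closed_openC/closed_closure.
- apply/set0P/negP => /eqP; rewrite setD_eq0 => UWE; apply: nE.
  exists i, (U `&` W); split => //; exact: openI.
- by move=> x [[]].
- by rewrite -subset0 => x [[_ nEx] [Ex _]]; apply: nEx; exact: subset_closure.
Qed.

End banach_category.

Section separability.
Context {R : realType} {X : normedModType R}.

Lemma separable_ball_base : separable_space X -> exists d : nat -> X,
  forall U : set X, open U -> U !=set0 ->
    exists m j, ball (d m) (harmonic j : R) `<=` U.
Proof.
move=> [D /countable_injP[c cI] dD].
exists (fun m => xget 0 (D `&` [set y | c y = m])) => U oU [u Uu].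
have /nbhs_ballP[e /= e0 eU] : nbhs u U by exact: open_nbhs_nbhs.
have [j je] : exists j : nat, harmonic j < e / 2 :> R.
  have e20 : 0 < e / 2 by rewrite divr_gt0.
  exact: filter_ex (near_infty_natSinv_lt (PosNum e20)).
have [||y [uy Dy]] := dD (ball u (harmonic j : R)).
- by exists u; apply: ballxx; exact: harmonic_gt0.
- exact: ball_open.
exists (c y), j.
have -> : xget 0 (D `&` [set z | c z = c y]) = y.
  have : (D `&` [set z | c z = c y]) y by [].
  by move=> /(xgetI 0)[Dg cg]; apply: cI => //; exact: mem_set.
move=> z yz; apply: eU; rewrite [e]splitr.
apply: (@ball_triangle _ _ y).
  exact: le_ball (ltW je) _ uy.
exact: le_ball (ltW je) _ yz.
Qed.

End separability.

(** * Directional thickness and directional porosity *)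

Section thickness.
Context {R : realType} {X : normedModType R}.
Implicit Types (A : set X) (x : X).

(** The direction [v = 0] is allowed because the directions to which thickness
    is applied, centres of cones or elements of a compact set, may vanish. For
    [x] in [A] that direction imposes nothing, hence the agreement with
    porosity, where the direction is nonzero. *)
Definition directionally_thick_at A x :=
  forall (v : X) (p : R), 0 < p -> exists2 d, 0 < d &
    forall t, 0 < t < d -> exists2 y, A y & `|x + t *: v - y| < p * t.

(** Testing thickness at the scales [1/(n+1)] produces the sequence of holes;
    the direction is nonzero because [x] itself would fill a hole about [x]. *)
Lemma not_thick_porous A B x : A x -> B `<=` A -> ~ directionally_thick_at A x ->
  directionally_porous_at B x.
Proof.
move=> Ax BA /existsNP[v] /existsNP[p] /not_implyP[p0] nt.
have /choice[t tP] n : exists t : R, 0 < t < harmonic n /\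
    forall y, A y -> ~ (`|x + t *: v - y| < p * t).
  apply: contrapT => h; apply: nt; exists (harmonic n) => [|t td]; first exact: harmonic_gt0.
  apply: contrapT => h2; apply: h; exists t; split => // y Ay yt.
  by apply: h2; exists y.
exists v, p, t; split => //.
- apply/eqP => v0; have [/andP[t0 _]] := tP 0%N; move=> /(_ x Ax); apply.
  by rewrite v0 scaler0 addr0 subrr normr0 mulr_gt0.
- by move=> n; have [/andP[]] := tP n.
- apply: (@squeeze_cvgr _ _ _ _ (fun=> 0) harmonic).
  + by near=> n; have [/andP[/ltW -> /ltW ->]] := tP n.
  + exact: cvg_cst.
  + exact: cvg_harmonic.
- move=> n; rewrite -subset0 => y [] ; rewrite -ball_normE /= => yt /BA Ay.
  by have [_ /(_ y Ay)] := tP n.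
Unshelve. all: by end_near. Qed.

Lemma thick_of_dense A U x : open U -> U x -> U `<=` closure A ->
  directionally_thick_at A x.
Proof.
move=> oU Ux UA v p p0.
have /nbhs0P : nbhs x U by exact: open_nbhs_nbhs.
move=> /nbhs_ballP[e /= e0 eU].
exists (e / (`|v| + 1)); first by rewrite divr_gt0// ltr_wpDl.
move=> t /andP[t0 td].
have /UA : U (x + t *: v).
  apply: eU; rewrite -ball_normE /= sub0r normrN normrZ gtr0_norm//.
  move: td; rewrite ltr_pdivlMr ?ltr_wpDl//; apply: le_lt_trans.
  by rewrite ler_pM2l// lerDl.
move=> /(_ (ball (x + t *: v) (p * t)))[].
  by apply: nbhsx_ballx; rewrite mulr_gt0.
by move=> y [Ay]; rewrite -ball_normE /= => yt; exists y.
Qed.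

Lemma sigma_directionally_porous_bigcup (I : countType) (A : I -> set X) :
  (forall i, directionally_porous (A i)) ->
  sigma_directionally_porous (\bigcup_i A i).
Proof.
move=> pA; exists (fun k => if unpickle k is Some i then A i else set0).
  by move=> k; case: unpickle.
rewrite predeqE => x; split=> [[i _ Ax]|[k _]].
  by exists (pickle i) => //; rewrite pickleK.
by case: unpickle => // i Ax; exists i.
Qed.

End thickness.

(** * From pointwise Lipschitz bounds to Hadamard differentiability *)

Section differentiability.
Context {R : realType} {X Y : normedModType R}.
Implicit Types (f : X -> Y) (x : X).

(** One index bounds both the constant and, inversely, the radius, so that the
    points with some local Lipschitz bound are a countable union. *)
Definition lipschitz_points f (m : nat) : set X :=
  [set x | forall y, `|x - y| < harmonic m -> `|f x - f y| <= m%:R * `|x - y|].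

Lemma is_derive_cvg f x v l : is_derive x v f l ->
  t^-1 *: (f (x + t *: v) - f x) @[t --> (0:R)^'] --> l.
Proof.
move=> [dfx <-].
rewrite (_ : (fun t : R => _) =
    fun t => t^-1 *: ((f \o shift x) (t *: v) - f x)); first exact: dfx.
by apply/funext => t /=; rewrite [x + _]addrC.
Qed.

(** A point [y] of the set with [|x + t v - y| < p t] is within [2 p t] of
    [x + t w] as soon as [|v - w| < p]; both values of [f] are compared with
    [f y], at a total cost of [3 m p t]. *)
Lemma thick_lipschitz_increment f m x : directionally_thick_at (lipschitz_points f m) x ->
  forall (v : X) (e : R), 0 < e -> exists2 d, 0 < d &
    forall t w, 0 < t < d -> `|v - w| < d ->
      `|f (x + t *: v) - f (x + t *: w)| <= e * t.
Proof.
move=> thick v e e0.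
(* [m.+1] rather than [m] because [m] may be zero *)
pose p : R := e / (3 * m.+1%:R).
have p0 : 0 < p by rewrite divr_gt0// mulr_gt0.
have [d d0 dP] := thick v p p0.
have h0 : 0 < @harmonic R m / (2 * p).
  by rewrite divr_gt0 ?harmonic_gt0// mulr_gt0.
exists (Num.min d (Num.min p (harmonic m / (2 * p)))); first by rewrite !lt_min d0 p0.
move=> t w /andP[t0]; rewrite !lt_min => /and3P[td tp th] /and3P[_ vwp _].
have [|y My yt] := dP t; first by rewrite t0 td.
have tph : 2 * (p * t) < harmonic m.
  by rewrite mulrA mulrC -ltr_pdivlMr ?mulr_gt0.
have yv : `|y - (x + t *: v)| <= p * t by rewrite distrC ltW.
have yw : `|y - (x + t *: w)| <= 2 * (p * t).
  rewrite (_ : y - _ = (y - (x + t *: v)) + t *: (v - w)); last first.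
    by rewrite scalerBr !opprD !addrA addrNK.
  rewrite (le_trans (ler_normD _ _))// mulr_natl mulr2n lerD//.
  by rewrite normrZ gtr0_norm// mulrC ler_pM2r// ltW.
have pt0 : 0 < p * t by rewrite mulr_gt0.
have fv : `|f y - f (x + t *: v)| <= m%:R * (p * t).
  rewrite (le_trans (My _ _)) ?ler_wpM2l//.
  by apply: le_lt_trans tph; rewrite (le_trans yv)// mulr_natl mulr2n lerDl ltW.
have fw : `|f y - f (x + t *: w)| <= m%:R * (2 * (p * t)).
  by rewrite (le_trans (My _ _)) ?ler_wpM2l//; exact: le_lt_trans tph.
rewrite (_ : f _ - _ = - (f y - f (x + t *: v)) + (f y - f (x + t *: w))); last first.
  by rewrite opprB addrA addrNK.
rewrite (le_trans (ler_normD _ _))// normrN (le_trans (lerD fv fw))//.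
rewrite (_ : e = 3 * m.+1%:R * p); last first.
  by rewrite /p mulrC divfK// mulf_neq0.
rewrite -mulrDr (_ : p * t + _ = 3 * (p * t)); last by ring.
rewrite (_ : 3 * _ * p * t = m.+1%:R * (3 * (p * t))); last by ring.
by rewrite ler_pM2r ?mulr_gt0// ler_nat.
Qed.

(** Near each direction [v] the quotients with directions [v] and [w] differ
    little, uniformly in [w]; compactness makes the scale of [t] uniform over
    the directions of [C]. *)
Lemma thick_lipschitz_hadamard f m x : gateaux_differentiable f x ->
  directionally_thick_at (lipschitz_points f m) x -> hadamard_differentiable f x.
Proof.
move=> [L [cL dL]] thick; exists L; split=> // C /compact_near_coveringP cC.
move=> P /uniform_nbhs[E [+ EP]]; rewrite -entourage_ballE => -[e /= e0 eE].
suff : \forall t \near (0:R)^', C `<=`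
    (fun v => ball (L v) e (t^-1 *: (f (x + t *: v) - f x))).
  apply: filterS => t Ct; apply: EP => v Cv; apply: eE => /=; exact: Ct.
apply: cC => v Cv.
have e30 : 0 < e / 3 by rewrite divr_gt0.
have [d1 d10 d1P] := thick_lipschitz_increment thick v e30.
(* thickness is one-sided; negative [t] amount to the opposite direction *)
have [d2 d20 d2P] := thick_lipschitz_increment thick (- v) e30.
have dv := is_derive_cvg (dL v).
near=> w t.
have t0 : t != 0 by near: t; exact: nbhs_dnbhs_neq.
have td1 : `|t| < d1 by near: t; exact: dnbhs0_lt.
have td2 : `|t| < d2 by near: t; exact: dnbhs0_lt.
have vw1 : `|v - w| < d1 by near: w; exact: cvgr_dist_lt.
have vw2 : `|v - w| < d2 by near: w; exact: cvgr_dist_lt.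
have Lvw : `|L v - L w| < e / 3 by near: w; apply: cvgr_dist_lt e30; exact: cL.
have fv : `|L v - t^-1 *: (f (x + t *: v) - f x)| < e / 3.
  by near: t; apply: cvgr_dist_lt e30.
have fvw : `|f (x + t *: v) - f (x + t *: w)| <= e / 3 * `|t|.
  have [tgt0|] := ltP 0 t.
    by rewrite gtr0_norm//; apply: d1P => //; rewrite tgt0 /= -[t]gtr0_norm.
  rewrite le_eqVlt (negPf t0) /= => tlt0.
  have tN z : t *: z = - t *: - z by rewrite scaleNr scalerN opprK.
  rewrite !tN ltr0_norm//; apply: d2P.
    by rewrite oppr_gt0 tlt0 /= -ltr0_norm.
  by rewrite -opprD normrN.
rewrite -ball_normE /=.
rewrite (_ : L w - _ = - (L v - L w) + (L v - t^-1 *: (f (x + t *: v) - f x)) +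
    t^-1 *: (f (x + t *: v) - f (x + t *: w))); last first.
  rewrite [- (L v - L w)]opprB [in RHS]addrA subrK -addrA; congr (_ + _).
  by rewrite -!scalerN -scalerDr !opprB addrA subrK.
have {}fvw : `|t^-1 *: (f (x + t *: v) - f (x + t *: w))| <= e / 3.
  by rewrite normrZ normfV mulrC ler_pdivrMr ?normr_gt0.
rewrite (le_lt_trans (ler_normD _ _))//.
rewrite (_ : e = e / 3 + e / 3 + e / 3); last by field.
rewrite ltr_leD// (le_lt_trans (ler_normD _ _))// normrN ltrD//.
Unshelve. all: by end_near. Qed.

End differentiability.

(** * Cones of controlled directions *)

Section affine_maps.
Context {R : realType} {X : normedModType R}.

Let affine_continuous (b : X) (c : R) : continuous (fun v : X => b + c *: v).
Proof.
by move=> v; apply: cvgD; [exact: cvg_cst|apply: cvgZl_tmp; exact: cvg_id].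
Qed.

Let affine_inv_continuous (b : X) (c : R) :
  continuous (fun y : X => c^-1 *: (y - b)).
Proof.
by move=> v; apply: cvgZl_tmp; apply: cvgB; [exact: cvg_id|exact: cvg_cst].
Qed.

Let affineK (b : X) (c : R) : c != 0 ->
  cancel (fun v : X => b + c *: v) (fun y => c^-1 *: (y - b)).
Proof. by move=> c0 v; rewrite addrC addKr scalerA mulVf// scale1r. Qed.

Let affine_invK (b : X) (c : R) : c != 0 ->
  cancel (fun y : X => c^-1 *: (y - b)) (fun v => b + c *: v).
Proof. by move=> c0 v; rewrite scalerA mulfV// scale1r addrC subrK. Qed.

Lemma affine_first_category (b : X) (c : R) (A : set X) : c != 0 ->
  first_category A -> first_category ((fun v => b + c *: v) @^-1` A).
Proof.
move=> c0; exact: (first_category_preimage (@affine_continuous b c)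
  (@affine_inv_continuous b c) (affineK b c0) (affine_invK b c0)).
Qed.

Lemma affine_almost_open (b : X) (c : R) (A : set X) : c != 0 ->
  almost_open A -> almost_open ((fun v => b + c *: v) @^-1` A).
Proof.
move=> c0; exact: (almost_open_preimage (@affine_continuous b c)
  (@affine_inv_continuous b c) (affineK b c0) (affine_invK b c0)).
Qed.

End affine_maps.

Section harmonic_steps.
Context {R : realType}.

Lemma harmonic_neq0 (k : nat) : harmonic k != 0 :> R.
Proof. by rewrite gt_eqF// harmonic_gt0. Qed.

Lemma cvg_harmonic_dnbhs : harmonic n @[n --> \oo] --> (0 : R)^'.
Proof.
move=> P P0.
have : \forall k \near \oo, harmonic k != 0 :> R -> P (harmonic k).
  exact: (cvg_harmonic P0).
by rewrite !near_simpl; apply: filterS => k; apply; exact: harmonic_neq0.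
Qed.

(** Lets the height of a cone be adapted to any small distance, although
    directions are controlled at the steps [1/(k+1)] only. *)
Lemma harmonic_comparable (q : R) : 0 < q <= 1 -> exists k, q <= harmonic k <= 2 * q.
Proof.
move=> /andP[q0 q1]; have q10 : 1 <= q^-1 by rewrite invf_ge1.
have := truncn_itv (le_trans ler01 q10).
have : (0 < Num.truncn q^-1)%N by rewrite truncn_gt0.
case: (Num.truncn _) => // k _ /andP[kq qk]; exists k.
rewrite /harmonic; apply/andP; split.
  by rewrite -[leLHS]invrK lef_pV2 ?posrE ?invr_gt0.
rewrite -[leRHS]invrK lef_pV2 ?posrE ?invr_gt0 ?mulr_gt0// invfM.
rewrite mulrC ler_pdivrMr// (le_trans (ltW qk))//.
by rewrite mulr_natr mulr2n -natr1 lerD2l ler1n.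
Qed.

End harmonic_steps.

Section cones.
Context {R : realType} {X : completeNormedModType R} {Y : normedModType R}.
Context (G : set X) (f : X -> Y).
Hypothesis openG : open G.
Implicit Types (x y v a : X).

Lemma gateaux_harmonic x v : gateaux_differentiable f x ->
  exists l, (harmonic k)^-1 *: (f (x + harmonic k *: v) - f x)
    @[k --> \oo] --> (l : Y).
Proof.
move=> [L [_ /(_ v)/is_derive_cvg dL]]; exists (L v).
exact: (cvg_comp _ _ cvg_harmonic_dnbhs dL).
Qed.

Lemma cvg_harmonic_ray x v : x + harmonic k *: v @[k --> \oo] --> x.
Proof.
rewrite -[X in _ --> X]addr0; apply: cvgD; first exact: cvg_cst.
by rewrite -[X in _ --> X](scale0r v); apply: cvgZr_tmp; exact: cvg_harmonic.
Qed.

Lemma gateaux_cvg_ray x v : gateaux_differentiable f x ->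
  f (x + harmonic k *: v) @[k --> \oo] --> f x.
Proof.
move=> /(gateaux_harmonic v)[l dl].
rewrite (_ : (fun k => f _) = fun k => f x +
    harmonic k *: ((harmonic k)^-1 *: (f (x + harmonic k *: v) - f x))).
  rewrite -[X in _ --> X]addr0; apply: cvgD; first exact: cvg_cst.
  by rewrite -[X in _ --> X](scale0r l); apply: cvgZ => //; exact: cvg_harmonic.
by apply/funext => k; rewrite scalerA mulfV ?harmonic_neq0// scale1r [RHS]addrC subrK.
Qed.

(** Only the countably many steps [1/(k+1)] with [k >= n] are used, so that this
    is a countable intersection of sets with the Baire property. *)
Definition controlled_directions (n : nat) x : set X :=
  \bigcap_k [set v | G (x + harmonic (n + k)%N *: v) /\
    `|f x - f (x + harmonic (n + k)%N *: v)| <= n%:R * harmonic (n + k)%N].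

Lemma controlled_directions_cover x v : G x -> gateaux_differentiable f x ->
  exists n, controlled_directions n x v.
Proof.
move=> Gx /(gateaux_harmonic v)[l dl].
have [N _ NG] : \forall k \near \oo, G (x + harmonic k *: v).
  by apply: (@cvg_harmonic_ray x v G); exact: open_nbhs_nbhs.
have [M _ Ml] : \forall k \near \oo,
    `|(harmonic k)^-1 *: (f (x + harmonic k *: v) - f x)| <= `|l| + 1.
  by apply: cvgr_norm_le dl _ _; rewrite ltrDl.
have [n [Nn Mn ln]] : exists n : nat, [/\ (N <= n)%N, (M <= n)%N & `|l| + 1 <= n%:R].
  suff : \forall n \near \oo, [/\ (N <= n)%N, (M <= n)%N & `|l| + 1 <= n%:R].
    by move=> /filter_ex.
  near=> n; split; near: n.
  - exact: nbhs_infty_ge.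
  - exact: nbhs_infty_ge.
  - exact: nbhs_infty_ger.
exists n => k _; split; first by apply: NG; exact: leq_trans (leq_addr _ _).
have h0 : 0 < @harmonic R (n + k) by exact: harmonic_gt0.
rewrite distrC -ler_pdivrMr// mulrC -[X in X * _]gtr0_norm ?invr_gt0// -normrZ.
by apply: le_trans ln; apply: Ml; exact: leq_trans (leq_addr _ _).
Unshelve. all: by end_near. Qed.

(** The bound at generic points of a cone with vertex [x] extends to all its
    points [y]: the directions [w] for which some [y + w/(i+1)] is exceptional
    form a meager set, and along any other [w] the values at these points, which
    eventually lie in the cone, tend to [f y]. *)
Lemma generic_value_bound n k a r x y :
  first_category (ball a r `\` controlled_directions n x) ->
  gateaux_differentiable f y -> (n <= k)%N ->
  `|(harmonic k)^-1 *: (y - x) - a| < r ->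
  `|f x - f y| <= n%:R * harmonic k.
Proof.
set B := _ `\` _ => mB dy nk yr.
pose h : R^nat := harmonic.
have h0 i : h i != 0 by exact: harmonic_neq0.
(* the coordinate of [w] as a direction seen from the vertex at height [h k] *)
pose g w := (h k)^-1 *: (w - x).
have gE i w : g (y + h i *: w) = (h k)^-1 *: (y - x) + ((h k)^-1 * h i) *: w.
  by rewrite /g addrAC scalerDr scalerA.
have [w wB] : exists w, forall i, ~ B (g (y + h i *: w)).
  apply: contrapT => nw.
  apply: (@open_not_first_category R X setT); [exact: openT|by exists 0|].
  apply: (@first_category_sub _ _ (\bigcup_i [set w | B (g (y + h i *: w))])).
    move=> w _; apply: contrapT => nBw; apply: nw; exists w => i Bi.
    by apply: nBw; exists i.
  apply: first_category_bigcup => i.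
  rewrite (_ : mkset _ =
      (fun w => (h k)^-1 *: (y - x) + ((h k)^-1 * h i) *: w) @^-1` B).
    by apply: affine_first_category => //; rewrite mulf_neq0 ?invr_eq0.
  by apply/funext => w; rewrite /= gE.
have cg : g (y + h i *: w) @[i --> \oo] --> g y.
  apply: cvgZl_tmp; apply: cvgB; last exact: cvg_cst.
  exact: cvg_harmonic_ray.
have : closed_ball_ Num.Def.normr (f x) (n%:R * harmonic k) (f y).
  have cf := gateaux_cvg_ray w dy.
  apply: (closed_cvg (closed_ball_ Num.Def.normr (f x) (n%:R * harmonic k))
    _ _ (f y) cf); first exact: closed_closed_ball_.
  have : \forall i \near \oo, ball a r (g (y + h i *: w)).
    apply: cg; apply: open_nbhs_nbhs; split; first exact: ball_open.
    by rewrite -ball_normE /= distrC.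
  apply: filterS => i ai.
  have : controlled_directions n x (g (y + h i *: w)).
    by apply: contrapT => nc; apply: (wB i).
  move=> /(_ (k - n)%N I)[_]; rewrite subnKC//.
  by rewrite /g scalerA mulfV// scale1r [x + _]addrC subrK.
by [].
Qed.

(** Up to a meager set is all that Baire's theorem gives;
    [generic_value_bound] removes the exception. *)
Definition cone_points (n : nat) a (r : R) : set X :=
  G `&` [set x | first_category (ball a r `\` controlled_directions n x)].

(** Thickness in the direction [- a] supplies a vertex [x'] of the set near
    [x - h a], where the step [h] is between [2 s / r] and [4 s / r] for
    [s = |x - y|]. Seen from [x'], both [x] and [y] have direction within
    [s / h + r / 2 <= r] of [a], so both values are within [n h <= 4 n s / r] of
    [f x'], and [8 n / r] is a Lipschitz constant at [x]. *)
Lemma thick_cone_lipschitz n a r x : 0 < r ->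
  (forall y, G y -> gateaux_differentiable f y) -> G x ->
  directionally_thick_at (cone_points n a r) x ->
  exists m, lipschitz_points f m x.
Proof.
move=> r0 df Gx thick.
have [d d0 dP] := thick (- a) (r / 2) (divr_gt0 r0 (ltr0Sn _ _)).
have /nbhs_ballP[e /= e0 eG] : nbhs x G by exact: open_nbhs_nbhs.
(* [s < q0] guarantees [4 s / r < d] and [4 s / r < 1/(n+1)], hence [h < d]
   and [n <= k] for the step [h = 1/(k+1)] *)
pose q0 : R := Num.min d (harmonic n) * r / 4.
have q00 : 0 < q0 by rewrite !mulr_gt0// lt_min d0 harmonic_gt0.
have [m [me [mq mC]]] : exists m : nat, harmonic m < e /\
    harmonic m < q0 /\ 8 / r * n%:R <= m%:R.
  suff : \forall m \near \oo, harmonic m < e /\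
    harmonic m < q0 /\ 8 / r * n%:R <= m%:R by move=> /filter_ex.
  near=> m; split; [|split]; near: m.
  - exact: (near_infty_natSinv_lt (PosNum e0)).
  - exact: (near_infty_natSinv_lt (PosNum q00)).
  - exact: nbhs_infty_ger.
exists m => y xym.
have [<-|yx] := eqVneq x y; first by rewrite !subrr !normr0 mulr0.
have s0 : 0 < `|x - y| by rewrite normr_gt0 subr_eq0.
have Gy : G y by apply: eG; rewrite -ball_normE /=; exact: lt_trans me.
set s := `|x - y| in xym s0 *.
have sq0 : s < q0 by exact: lt_trans mq.
have q2 : 2 * (2 * s / r) < Num.min d (harmonic n).
  move: sq0; rewrite /q0 ltr_pdivlMr// -ltr_pdivrMr//.
  by apply: le_lt_trans; rewrite le_eqVlt; apply/orP; left; apply/eqP; field; rewrite gt_eqF.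
have qpos : 0 < 2 * s / r by rewrite !mulr_gt0// invr_gt0.
have [|k /andP[kq k2q]] := @harmonic_comparable R (2 * s / r).
  have hn1 : harmonic n <= 1 :> R by rewrite invf_le1// ler1n.
  by move: q2 qpos; rewrite lt_min => /andP[_]; lra.
have kmin := le_lt_trans k2q q2.
move: kmin; rewrite lt_min => /andP[kd kn].
have nk : (n <= k)%N.
  by move: kn; rewrite /harmonic ltf_pV2 ?posrE// ltr_nat => /ltnW; rewrite ltnS.
have hk0 : 0 < @harmonic R k by exact: harmonic_gt0.
have [|x' [Gx' mx'] xx'] := dP (harmonic k); first by rewrite hk0.
have near_cone z : `|z - x| <= s -> `|(harmonic k)^-1 *: (z - x') - a| < r.
  move=> zx.
  rewrite (_ : _ - a = (harmonic k)^-1 *: ((z - x) + (x + harmonic k *: - a - x'))).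
    rewrite normrZ gtr0_norm ?invr_gt0// mulrC ltr_pdivrMr//.
    rewrite (le_lt_trans (ler_normD _ _))//.
    rewrite (_ : r * _ = r / 2 * harmonic k + r / 2 * harmonic k); last by field.
    rewrite ler_ltD// (le_trans zx)//.
    rewrite mulrC -ler_pdivrMr ?divr_gt0//.
    by apply: le_trans kq; rewrite le_eqVlt; apply/orP; left; apply/eqP; field; rewrite gt_eqF.
  have -> : z - x + (x + harmonic k *: - a - x') = (z - x') + harmonic k *: - a.
    by rewrite !addrA subrK addrAC.
  by rewrite [RHS]scalerDr scalerA mulVf ?gt_eqF// scale1r.
have bx : `|f x' - f x| <= n%:R * harmonic k.
  apply: (generic_value_bound mx' (df x Gx) nk).
  by apply: near_cone; rewrite subrr normr0 ltW.
have by_ : `|f x' - f y| <= n%:R * harmonic k.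
  apply: (generic_value_bound mx' (df y Gy) nk).
  by apply: near_cone; rewrite distrC.
rewrite (_ : f x - f y = - (f x' - f x) + (f x' - f y)); last first.
  by rewrite opprB addrA subrK.
rewrite (le_trans (ler_normD _ _))// normrN (le_trans (lerD bx by_))//.
rewrite (le_trans _ (ler_wpM2r (ltW s0) mC))//.
rewrite (_ : 8 / r * n%:R * s = n%:R * (2 * (2 * s / r)) + n%:R * (2 * (2 * s / r))).
  by rewrite lerD// ler_wpM2l.
by field; rewrite gt_eqF.
Unshelve. all: by end_near. Qed.

Lemma almost_open_controlled_directions n x : has_baire_property (sigL G f) ->
  almost_open (controlled_directions n x).
Proof.
move=> baire_f; apply: almost_open_bigcap => k.
set h := harmonic _.
have h0 : h != 0 by exact: harmonic_neq0.
set A := [set y | G y /\ `|f x - f y| <= n%:R * h].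
rewrite (_ : mkset _ = (fun v => x + h *: v) @^-1` A)//.
apply: affine_almost_open => //.
have -> : A = set_val @` (sigL G f @^-1` closed_ball_ Num.Def.normr (f x) (n%:R * h)).
  rewrite predeqE => y; split => [[Gy fy]|[z fz <-]].
    by exists (SigSub (mem_set Gy)).
  by split => //; exact: set_valP.
apply: baire_property_set_val_image => //; apply: baire_f.
rewrite -[X in _ X]setCK -setTD; apply: sigma_algebraCD.
by apply: sub_sigma_algebra; exact/closed_openC/closed_closed_ball_.
Qed.

(** The controlled directions at [x] exhaust [X] as [n] grows, so by Baire's
    theorem some class of them is non-meager; having the Baire property, it is
    residual in an open set. *)
Lemma cone_points_cover (d : nat -> X) x : has_baire_property (sigL G f) ->
  (forall U : set X, open U -> U !=set0 ->
    exists m j, ball (d m) (harmonic j : R) `<=` U) ->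
  G x -> gateaux_differentiable f x ->
  exists n m j, cone_points n (d m) (harmonic j) x.
Proof.
move=> baire_f base Gx dx.
have [n [U [oU U0 mU]]] : exists n U, [/\ open U, U !=set0 &
    first_category ((controlled_directions n x `\` U) `|`
                    (U `\` controlled_directions n x))].
  apply: contrapT => nU.
  apply: (@open_not_first_category R X setT); [exact: openT|by exists 0|].
  apply: (@first_category_sub _ _ (\bigcup_n controlled_directions n x)).
    move=> v _; have [n nv] := controlled_directions_cover v Gx dx.
    by exists n.
  apply: first_category_bigcup => n.
  have [U oU mU] := almost_open_controlled_directions n x baire_f.
  apply: (first_category_sub _ mU) => v nv; left; split => // Uv.
  by apply: nU; exists n, U; split => //; exists v.
have [m [j djU]] := base U oU U0; exists n, m, j; split => //=.
by apply: first_category_sub mU => v [/djU Uv nv]; right.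
Qed.

End cones.

(** * Conclusion *)

Theorem theorem3p9 (R : realType) (X Y : completeNormedModType R)
    (G : set X) (f : X -> Y)
    (sepX : separable_space X)
    (openG : open G)
    (baire_f : has_baire_property (sigL G f))
    (gateaux_f : forall x, G x -> gateaux_differentiable f x) :
  nowhere_dense (G `\` [set x | hadamard_differentiable f x]) /\
  sigma_directionally_porous (G `\` [set x | hadamard_differentiable f x]).
Proof.
have [d base] := separable_ball_base sepX.
pose E (i : nat * nat * nat) : set X :=
  let: (n, m, j) := i in cone_points G f n (d m) (harmonic j).
have GE : G `<=` \bigcup_i E i.
  move=> x Gx; have [n [m [j Ex]]] :=
    cone_points_cover openG baire_f base Gx (gateaux_f x Gx).
  by exists (n, m, j).
have lipE i x : G x -> directionally_thick_at (E i) x ->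
    exists m, lipschitz_points f m x.
  case: i => [[n m] j] Gx; apply: thick_cone_lipschitz => //.
  exact: harmonic_gt0.
split.
  (* one application of Baire's theorem for each of the two families *)
  apply/nowhere_denseP => U oU U0.
  have [UG|/set0P UG] := eqVneq (U `&` G) set0.
    by exists U; split => //; rewrite setIDA UG set0D.
  have [|i [V [oV V0 VUG VE]]] := open_cover_somewhere_dense (openI oU openG) UG (E := E).
    by move=> x [_ /GE].
  have [|m [W [oW W0 WV WL]]] :=
      open_cover_somewhere_dense oV V0 (E := lipschitz_points f).
    move=> x Vx; have [_ Gx] := VUG _ Vx.
    by have [m mx] := lipE i x Gx (thick_of_dense oV Vx VE); exists m.
  exists W; split => //; first by move=> x /WV/VUG[].
  rewrite -subset0 => x [Wx [Gx]]; apply.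
  exact: thick_lipschitz_hadamard (gateaux_f x Gx) (thick_of_dense oW Wx WL).
set N := _ `\` _.
pose P := \bigcup_m lipschitz_points f m.
(* a point outside [P] cannot be a thick point of the [E i] that contains it *)
pose F (k : nat + nat * nat * nat) := N `&`
  match k with inl m => lipschitz_points f m | inr i => E i `\` P end.
have -> : N = \bigcup_k F k.
  apply/seteqP; split=> [x Nx|x [k _ []//]].
  have [[m _ mx]|nP] := pselect (P x); first by exists (inl m).
  by have [i _ Eix] := GE x Nx.1; exists (inr i).
apply: sigma_directionally_porous_bigcup => -[m|i] x [Nx].
  move=> mx; apply: (not_thick_porous mx (@subIsetr _ _ _)) => thick.
  by apply: Nx.2; exact: thick_lipschitz_hadamard (gateaux_f x Nx.1) thick.
move=> [Ex nPx]; apply: (@not_thick_porous _ _ (E i)) => //.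
  by move=> y [_ []].
by move=> /(lipE i x Nx.1)[m mx]; apply: nPx; exists m.
Qed.
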